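(* Let $M^n=\overline M^p\times\widetilde M^{n-p}$ be a product manifold and let $\Pi,\Phi,\Psi,\Theta$ be $1$-forms on $M$. Then $M$ is a $SGK_n$ with $(\Pi,\Phi,\Psi,\Theta)$ if and only if (at every point of $U$): 1.(i) $\overline\nabla\,\overline R=\overline\Pi\otimes\overline R+\overline\Phi\otimes\overline S\wedge\overline S+\overline\Psi\otimes\overline g\wedge\overline S+\overline\Theta\otimes\overline g\wedge\overline g$, 1.(ii) $-\widetilde\Pi\otimes\overline R=\widetilde\Phi\otimes\overline S\wedge\overline S+\widetilde\Psi\otimes\overline g\wedge\overline S+\widetilde\Theta\otimes\overline g\wedge\overline g$; 2.(i) $\widetilde\nabla\widetilde R=\widetilde\Pi\otimes\widetilde R+\widetilde\Phi\otimes\widetilde S\wedge\widetilde S+\widetilde\Psi\otimes\widetilde g\wedge\widetilde S+\widetilde\Theta\otimes\widetilde g\wedge\widetilde g$, 2.(ii) $-\overline\Pi\otimes\widetilde R=\overline\Phi\otimes\widetilde S\wedge\widetilde S+\overline\Psi\otimes\widetilde g\wedge\widetilde S+\overline\Theta\otimes\widetilde g\wedge\widetilde g$; 3.(i) $\left[2\overline\Phi\otimes\overline S+\overline\Psi\otimes\overline g\right]\otimes\widetilde S=-\left[\overline\Psi\otimes\overline S+2\overline\Theta\otimes\overline g\right]\otimes\widetilde g$, 3.(ii) $\left[2\widetilde\Phi\otimes\widetilde S+\widetilde\Psi\otimes\widetilde g\right]\otimes\overline S=-\left[\widetilde\Psi\otimes\widetilde S+2\widetilde\Theta\otimes\widetilde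 g\right]\otimes\overline g$.
   Context: Curvature conventions. For a semi-Riemannian metric $g$ with Levi-Civita connection $\nabla$: $R_{ijkl}=g\big((\nabla_{\partial_j}\nabla_{\partial_i}-\nabla_{\partial_i}\nabla_{\partial_j})\partial_k,\partial_l\big)$ is the $(0,4)$ Riemann-Christoffel tensor and $S_{jk}=g^{il}R_{ijkl}$ the Ricci tensor. For symmetric $(0,2)$-tensors $A,E$, the Kulkarni-Nomizu product is $(A\wedge E)_{ijkl}=A_{il}E_{jk}+A_{jk}E_{il}-A_{ik}E_{jl}-A_{jl}E_{ik}$. In $\nabla R=\Pi\otimes R+\dots$ the $1$-form index is the differentiation index: $R_{ijkl,m}=\Pi_mR_{ijkl}+\dots$. Product. $(\overline M,\overline g)$ and $(\widetilde M,\widetilde g)$ are semi-Riemannian manifolds of dimensions $p$ and $n-p$ ($1\le p<n$, $n\ge3$) and $M=\overline M\times\widetilde M$ carries the product metric $g=\overline g+\widetilde g$; $M$ is assumed non-flat. Overlined (resp. tilded) tensors $\overline R,\overline S,\overline\nabla$ (resp. $\widetilde R,\widetilde S,\widetilde\nabla$) are those of $\overline g$ (resp. $\widetilde g$) pulled back to $M$; tensor products of base and fibre tensors are compared componentwise, irrespective of the order of factors. For a $1$-form $\Pi$ on $M$, $\overline\Pi$ and $\widetilde\Pi$ denote its parts with components along $\overline M$ and $\widetilde M$ respectively (components are functions on $M$), and similarly for $\Phi,\Psi,\Theta$. Definition. Let $U=\{x\in M:\nabla R\ne\xi\otimes R\text{ at }x\text{ for every }1\text{-form }\xi\}$. $M$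 is a $SGK_n$ (super generalized recurrent) with $(\Pi,\Phi,\Psi,\Theta)$ if $\nabla R=\Pi\otimes R+\Phi\otimes S\wedge S+\Psi\otimes g\wedge S+\Theta\otimes g\wedge g$ holds on $U$. *)

(* Defs.v *)
From mathcomp Require Import all_boot all_order all_algebra.
From mathcomp Require Import lra.
From mathcomp Require Import all_classical all_reals.
From mathcomp Require Import topology normedtype derive.

Set Implicit Arguments.
Unset Strict Implicit.
Unset Printing Implicit Defensive.

Import Order.TTheory GRing.Theory Num.Theory.
Import numFieldNormedType.Exports.

Local Open Scope classical_set_scope.
Local Open Scope ring_scope.

Section Smooth.
Variable R : realType.

Definition pd n (i : 'I_n) (f : 'rV[R]_n -> R) : 'rV[R]_n -> R :=
  fun y => 'D_(delta_mx 0 i) f y.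

Definition pds n (l : seq 'I_n) (f : 'rV[R]_n -> R) : 'rV[R]_n -> R :=
  foldr (@pd n) f l.

(* C^infinity on an open set D: the partial derivatives of all orders exist
   and are continuous at every point of D. *)
Definition smooth_on n (D : set 'rV[R]_n) (f : 'rV[R]_n -> R) : Prop :=
  forall (l : seq 'I_n) (y : 'rV[R]_n), D y ->
    {for y, continuous (pds l f)} /\
    forall i : 'I_n, derivable (pds l f) y (delta_mx 0 i).

(* Entry (i, a) is d_i f^a, so that the chain rule reads
   v |-> v *m jac f y on row vectors. *)
Definition jac m n (f : 'rV[R]_m -> 'rV[R]_n) (y : 'rV[R]_m) : 'M[R]_(m, n) :=
  \matrix_(i, a) pd i (fun z => f z 0 a) y.

End Smooth.

(* A smooth manifold of dimension n, given by a smooth atlas.  [cmap c] and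
   [cinv c] are total functions, meaningful only on [cdom c] and on its
   image. *)
Record manifold (R : realType) (n : nat) := Manifold {
  mspace :> topologicalType;
  mspace_hausdorff : hausdorff_space mspace;
  mspace_countable : @second_countable mspace;
  chart : Type;
  cdom : chart -> set mspace;
  cmap : chart -> mspace -> 'rV[R]_n;
  cinv : chart -> 'rV[R]_n -> mspace;
  cdom_open : forall c, open (cdom c);
  cdom_cover : forall x, exists c, cdom c x;
  cimg_open : forall c, open (cmap c @` cdom c);
  cmapK : forall c x, cdom c x -> cinv c (cmap c x) = x;
  cmap_continuous : forall c x, cdom c x -> {for x, continuous (cmap c)};
  cinv_continuous : forall c y, (cmap c @` cdom c) y ->
    {for y, continuous (cinv c)};
  transition_smooth : forall c d (a : 'I_n),
    smooth_on (cmap c @` (cdom c `&` cdom d))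
      (fun y => cmap d (cinv c y) 0 a)
}.

Definition cimg (R : realType) n (M : manifold R n) (c : chart M) :
  set 'rV[R]_n := cmap c @` cdom c.

Definition transition (R : realType) n (M : manifold R n) (c d : chart M) :
  'rV[R]_n -> 'rV[R]_n := fun y => cmap d (cinv c y).

Definition overlap (R : realType) n (M : manifold R n) (c d : chart M) :
  set 'rV[R]_n := cmap c @` (cdom c `&` cdom d).

(* A semi-Riemannian metric, given by its components in the charts.  Constancy
   of the index: at every point there is a basis (the rows of P) that is
   orthonormal with signs (-1) ^+ s i, where s does not depend on the point. *)
Record metric (R : realType) n (M : manifold R n) := Metric {
  gcomp : chart M -> 'rV[R]_n -> 'M[R]_n;
  gcomp_smooth : forall c i j, smooth_on (cimg c) (fun y => gcomp c y i j);
  gcomp_sym : forall c y, cimg c y -> (gcomp c y)^T = gcomp c y;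
  gcomp_unit : forall c y, cimg c y -> gcomp c y \in unitmx;
  gcomp_signature : exists s : 'I_n -> bool, forall c y, cimg c y ->
    exists2 P : 'M[R]_n, P \in unitmx &
      P *m gcomp c y *m P^T = diag_mx (\row_i (-1) ^+ s i);
  gcomp_transition : forall c d y, overlap c d y ->
    gcomp c y = jac (transition c d) y *m gcomp d (transition c d y)
                *m (jac (transition c d) y)^T
}.

Record one_form (R : realType) n (M : manifold R n) := OneForm {
  wcomp : chart M -> 'rV[R]_n -> 'rV[R]_n;
  wcomp_smooth : forall c i, smooth_on (cimg c) (fun y => wcomp c y 0 i);
  wcomp_transition : forall c d y, overlap c d y ->
    wcomp c y = wcomp d (transition c d y) *m (jac (transition c d) y)^T
}.

Notation idx2 n := ('I_n * 'I_n)%type.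
Notation idx4 n := ('I_n * 'I_n * 'I_n * 'I_n)%type.

Section Tensors.
Variables (R : realType) (n : nat) (M : manifold R n).
(* Components of covariant tensor fields, as functions of the chart, of the
   coordinates and of a multi-index in I; sums, opposites and multiples are
   those of functions. *)
Local Notation tens I := (chart M -> 'rV[R]_n -> I -> R).

Definition teq_at (x : M) I (A B : tens I) : Prop :=
  forall c, cdom c x -> A c (cmap c x) =1 B c (cmap c x).

Definition tprod I J (A : tens I) (B : tens J) : tens (I * J) :=
  fun c y ij => A c y ij.1 * B c y ij.2.

Definition KN (A E : tens (idx2 n)) : tens (idx4 n) :=
  fun c y '(i, j, k, l) =>
    A c y (i, l) * E c y (j, k) + A c y (j, k) * E c y (i, l)
    - A c y (i, k) * E c y (j, l) - A c y (j, l) * E c y (i, k).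

Local Notation "A \ox B" := (tprod A B) (at level 40, left associativity).
Local Notation "A \kn B" := (KN A B) (at level 40, left associativity).

Definition form_tensor (w : one_form M) : tens 'I_n :=
  fun c y i => wcomp w c y 0 i.

Variable g : metric M.

Definition metric_tensor : tens (idx2 n) := fun c y '(i, j) => gcomp g c y i j.

Section Chart.
Variable c : chart M.

(* [christoffel i j k y] is Gamma^k_ij. *)
Definition christoffel (i j k : 'I_n) (y : 'rV[R]_n) : R :=
  2^-1 * \sum_l invmx (gcomp g c y) k l *
    (pd i (fun z => gcomp g c z j l) y + pd j (fun z => gcomp g c z i l) y
     - pd l (fun z => gcomp g c z i j) y).

(* Levi-Civita derivative of the vector field V along d/dy_i. *)
Definition cov (i : 'I_n) (V : 'rV[R]_n -> 'rV[R]_n) (y : 'rV[R]_n) :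
    'rV[R]_n :=
  \row_s (pd i (fun z => V z 0 s) y + \sum_t christoffel i t s y * V y 0 t).

Definition coord_field (k : 'I_n) : 'rV[R]_n -> 'rV[R]_n :=
  fun=> delta_mx 0 k.

Definition riemann_comp (i j k l : 'I_n) (y : 'rV[R]_n) : R :=
  ((cov j (cov i (coord_field k)) y - cov i (cov j (coord_field k)) y)
     *m gcomp g c y) 0 l.

End Chart.

Definition riemann : tens (idx4 n) :=
  fun c y '(i, j, k, l) => riemann_comp c i j k l y.

Definition ricci : tens (idx2 n) :=
  fun c y '(j, k) =>
    \sum_i \sum_l invmx (gcomp g c y) i l * riemann c y (i, j, k, l).

(* R_{ijkl,m}, with the differentiation index m first. *)
Definition nabla_riemann : tens ('I_n * idx4 n) :=
  fun c y '(m, (i, j, k, l)) =>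
    pd m (fun z => riemann c z (i, j, k, l)) y
    - \sum_s (christoffel c m i s y * riemann c y (s, j, k, l)
              + christoffel c m j s y * riemann c y (i, s, k, l)
              + christoffel c m k s y * riemann c y (i, j, s, l)
              + christoffel c m l s y * riemann c y (i, j, k, s)).

Definition flat : Prop := forall x, teq_at x riemann 0.

(* The points at which nabla R is not of the form xi (x) R. *)
Definition nonrecurrent_set : set M :=
  [set x | forall xi : one_form M,
     ~ teq_at x nabla_riemann (form_tensor xi \ox riemann)].

Definition SGK (Pi Phi Psi Theta : one_form M) : Prop :=
  forall x, nonrecurrent_set x ->
    teq_at x nabla_riemann
      (form_tensor Pi \ox riemann
       + form_tensor Phi \ox (ricci \kn ricci)
       + form_tensor Psi \ox (metric_tensor \kn ricci)
       + form_tensor Theta \ox (metric_tensor \kn metric_tensor)).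

End Tensors.

Notation "A \ox B" := (tprod A B) (at level 40, left associativity) : ring_scope.
Notation "A \kn B" := (KN A B) (at level 40, left associativity) : ring_scope.

Section LeviCivita.
Variables (R : realType) (n : nat) (M : manifold R n) (g : metric M).
Variables (c : chart M) (y : 'rV[R]_n).
Hypothesis cy : cimg c y.

Lemma pd_gcomp_sym k i j :
  pd k (fun z => gcomp g c z i j) y = pd k (fun z => gcomp g c z j i) y.
Proof.
apply: near_eq_derive; have : nbhs y (cimg c).
  by apply: open_nbhs_nbhs; split => //; exact: cimg_open.
by apply: filterS => z cz; rewrite -[in LHS](gcomp_sym g cz) mxE.
Qed.

(* Koszul formula; with the next two lemmas, the connection [cov] is torsion
   free and metric. *)
Lemma christoffel_lower i j k :
  \sum_s christoffel g c i j s y * gcomp g c y s k =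
  2^-1 * (pd i (fun z => gcomp g c z j k) y + pd j (fun z => gcomp g c z i k) y
          - pd k (fun z => gcomp g c z i j) y).
Proof.
rewrite /christoffel; set D := fun l => pd i (fun z => gcomp g c z j l) y +
  pd j (fun z => gcomp g c z i l) y - pd l (fun z => gcomp g c z i j) y.
transitivity (2^-1 * \sum_l D l * \sum_s gcomp g c y k s * invmx (gcomp g c y) s l).
  under eq_bigr do rewrite -mulrA mulr_suml.
  rewrite -mulr_sumr exchange_big /=; congr (_ * _); apply: eq_bigr => l _.
  rewrite mulr_sumr; apply: eq_bigr => s _.
  rewrite -[in gcomp g c y k s](gcomp_sym g cy) mxE.
  by rewrite mulrAC [RHS]mulrC [gcomp _ _ _ _ _ * _]mulrC.
have kE l : \sum_s gcomp g c y k s * invmx (gcomp g c y) s l = (k == l)%:R.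
  have := congr1 (fun A : 'M_n => A k l) (mulmxV (gcomp_unit g cy)).
  by rewrite !mxE.
rewrite (bigD1 k) //= kE eqxx mulr1 big1 ?addr0 // => l lk.
by rewrite kE eq_sym (negbTE lk) mulr0.
Qed.

Lemma christoffel_torsion_free i j k :
  christoffel g c i j k y = christoffel g c j i k y.
Proof.
rewrite /christoffel; congr (_ * _); apply: eq_bigr => l _.
by rewrite (pd_gcomp_sym l i j) [pd i _ _ + _]addrC.
Qed.

Lemma christoffel_metric i j k :
  pd k (fun z => gcomp g c z i j) y =
  \sum_s (christoffel g c k i s y * gcomp g c y s j
          + christoffel g c k j s y * gcomp g c y i s).
Proof.
rewrite big_split /= christoffel_lower.
under [X in _ + X]eq_bigr do rewrite -[in gcomp g c y i _](gcomp_sym g cy) mxE.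
rewrite christoffel_lower.
have := pd_gcomp_sym k i j; have := pd_gcomp_sym i k j.
have := pd_gcomp_sym j k i; lra.
Qed.

End LeviCivita.

Section SmoothPullback.
Variables (R : realType) (m n : nat) (L : {linear 'rV[R]_n -> 'rV[R]_m}).
Variable u : 'I_n -> option 'I_m.
Hypothesis L_continuous : continuous L.
Hypothesis L_delta : forall i, L (delta_mx 0 i) = oapp (delta_mx 0) 0 (u i).

Lemma pd_comp i (f : 'rV[R]_m -> R) :
  pd i (f \o L) = oapp (fun j => pd j f \o L) (cst 0) (u i).
Proof.
apply/funext => y; rewrite /pd /derive.
rewrite [X in X @ _](_ : _ = (fun h : R => h^-1 *:
    (f (h *: oapp (delta_mx 0) 0 (u i) + L y) - f (L y)))); last first.
  by apply/funext => h /=; rewrite [L _]linearD [L (h *: _)]linearZ L_delta.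
case: (u i) => [j|] //=; apply: norm_lim_near_cst.
by apply: nearW => h; rewrite scaler0 add0r subrr scaler0.
Qed.

Lemma derivable_comp_lin i (f : 'rV[R]_m -> R) y :
  (forall j, derivable f (L y) (delta_mx 0 j)) ->
  derivable (f \o L) y (delta_mx 0 i).
Proof.
move=> df; rewrite /derivable.
rewrite [X in X @ _](_ : _ = (fun h : R => h^-1 *:
    (f (h *: oapp (delta_mx 0) 0 (u i) + L y) - f (L y)))); last first.
  by apply/funext => h /=; rewrite [L _]linearD [L (h *: _)]linearZ L_delta.
case: (u i) => [j|] /=; first exact: df.
by apply: (@is_cvg_near_cst _ _ (0 : R)); apply: nearW => h; rewrite scaler0 add0r subrr scaler0.
Qed.

Lemma pds_comp l (f : 'rV[R]_m -> R) :
  pds l (f \o L) = cst 0 \/ exists l', pds l (f \o L) = pds l' f \o L.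
Proof.
elim: l => [|i l [ih|[l' ih]]] /=; first by right; exists [::].
- left; rewrite ih; apply/funext => y; exact: derive_cst.
- rewrite ih pd_comp; case: (u i) => [j|] /=; last by left.
  by right; exists (j :: l').
Qed.

Lemma smooth_on_comp D (f : 'rV[R]_m -> R) :
  smooth_on D f -> smooth_on (L @^-1` D) (f \o L).
Proof.
move=> sf l y Dy; case: (pds_comp l f) => [->|[l' ->]].
  split; first exact: cst_continuous.
  by move=> i; exact: derivable_cst.
have [cf df] := sf l' _ Dy; split.
  by apply: continuous_comp; [exact: L_continuous | exact: cf].
by move=> i; apply: derivable_comp_lin => j; exact: df.
Qed.

End SmoothPullback.

Section SmoothProduct.
Variables (R : realType) (p q : nat).

(* The index of the base, resp. fibre, coordinate numbered i, if any. *)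
Definition lidx (i : 'I_(p + q)) : option 'I_p :=
  if fintype.split i is inl a then Some a else None.
Definition ridx (i : 'I_(p + q)) : option 'I_q :=
  if fintype.split i is inr b then Some b else None.

Lemma lidx_lshift a : lidx (lshift q a) = Some a.
Proof. by rewrite /lidx (unsplitK (inl a)). Qed.
Lemma lidx_rshift b : lidx (rshift p b) = None.
Proof. by rewrite /lidx (unsplitK (inr b)). Qed.
Lemma ridx_lshift a : ridx (lshift q a) = None.
Proof. by rewrite /ridx (unsplitK (inl a)). Qed.
Lemma ridx_rshift b : ridx (rshift p b) = Some b.
Proof. by rewrite /ridx (unsplitK (inr b)). Qed.

Lemma lsubmx_delta i :
  lsubmx (delta_mx 0 i : 'rV[R]_(p + q)) = oapp (delta_mx 0) 0 (lidx i).
Proof.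
apply/rowP => j; rewrite mxE; case: (splitP i) => k ik.
  have -> : i = lshift q k by apply/val_inj.
  by rewrite lidx_lshift !mxE (inj_eq (@lshift_inj _ _)).
have -> : i = rshift p k by apply/val_inj.
by rewrite lidx_rshift !mxE eq_lrshift.
Qed.

Lemma rsubmx_delta i :
  rsubmx (delta_mx 0 i : 'rV[R]_(p + q)) = oapp (delta_mx 0) 0 (ridx i).
Proof.
apply/rowP => j; rewrite mxE; case: (splitP i) => k ik.
  have -> : i = lshift q k by apply/val_inj.
  by rewrite ridx_lshift !mxE eq_rlshift.
have -> : i = rshift p k by apply/val_inj.
by rewrite ridx_rshift !mxE (inj_eq (@rshift_inj _ _)).
Qed.

Lemma smooth_on_lsubmx (D : set 'rV[R]_p) (E : set 'rV[R]_(p + q)) f F :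
  smooth_on D f -> E `<=` lsubmx @^-1` D -> F = f \o lsubmx -> smooth_on E F.
Proof.
move=> sf ED -> l y /ED Dy.
exact: (smooth_on_comp (@continuous_lsubmx _ _ _ _) lsubmx_delta sf).
Qed.

Lemma smooth_on_rsubmx (D : set 'rV[R]_q) (E : set 'rV[R]_(p + q)) f F :
  smooth_on D f -> E `<=` rsubmx @^-1` D -> F = f \o rsubmx -> smooth_on E F.
Proof.
move=> sf ED -> l y /ED Dy.
exact: (smooth_on_comp (@continuous_rsubmx _ _ _ _) rsubmx_delta sf).
Qed.

Lemma smooth_on0 (E : set 'rV[R]_(p + q)) : smooth_on E (cst 0).
Proof.
have h l : pds l (cst 0 : 'rV[R]_(p + q) -> R) = cst 0.
  by elim: l => //= i l ->; apply/funext => y; exact: derive_cst.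
move=> l y _; rewrite h; split; first exact: cst_continuous.
by move=> i; exact: derivable_cst.
Qed.

(* The Jacobian of a product map is block diagonal. *)
Lemma jac_prod m n (f : 'rV[R]_p -> 'rV[R]_m) (h : 'rV[R]_q -> 'rV[R]_n) y :
  jac (fun z => row_mx (f (lsubmx z)) (h (rsubmx z))) y =
  block_mx (jac f (lsubmx y)) 0 0 (jac h (rsubmx y)).
Proof.
apply/matrixP => i a; rewrite mxE.
have L0 := pd_comp lsubmx_delta i; have R0 := pd_comp rsubmx_delta i.
case: (splitP a) => k ak.
  have -> : a = lshift n k by apply/val_inj.
  rewrite (_ : (fun z => _) = (fun x => f x 0 k) \o lsubmx); last first.
    by apply/funext => z /=; rewrite row_mxEl.
  rewrite L0; case: (splitP i) => l il.
    have -> : i = lshift q l by apply/val_inj.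
    by rewrite lidx_lshift block_mxEul mxE.
  have -> : i = rshift p l by apply/val_inj.
  by rewrite lidx_rshift block_mxEdl mxE.
have -> : a = rshift m k by apply/val_inj.
rewrite (_ : (fun z => _) = (fun x => h x 0 k) \o rsubmx); last first.
  by apply/funext => z /=; rewrite row_mxEr.
rewrite R0; case: (splitP i) => l il.
  have -> : i = lshift q l by apply/val_inj.
  by rewrite ridx_lshift block_mxEur mxE.
have -> : i = rshift p l by apply/val_inj.
by rewrite ridx_rshift block_mxEdr mxE.
Qed.

End SmoothProduct.

Section ProductTopology.

Lemma hausdorff_prod (S T : topologicalType) :
  hausdorff_space S -> hausdorff_space T -> hausdorff_space (S * T)%type.
Proof.
move=> hS hT [a b] [c d] cl; congr (_, _).
  apply: hS => A B nA nB.
  have [||z [[Az _] [Bz _]]] := cl (A `*` setT) (B `*` setT).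
  - by exists (A, setT) => //; split => //; exact: filterT.
  - by exists (B, setT) => //; split => //; exact: filterT.
  by exists z.1.
apply: hT => A B nA nB.
have [||z [[_ Az] [_ Bz]]] := cl (setT `*` A) (setT `*` B).
- by exists (setT, A) => //; split => //; exact: filterT.
- by exists (setT, B) => //; split => //; exact: filterT.
by exists z.2.
Qed.

Lemma openX (S T : topologicalType) (A : set S) (B : set T) :
  open A -> open B -> open (A `*` B).
Proof.
move=> oA oB; rewrite openE => -[a b] [Aa Bb].
by exists (A, B) => //; split; exact: open_nbhs_nbhs.
Qed.

Lemma second_countable_prod (S T : topologicalType) :
  @second_countable S -> @second_countable T ->
  @second_countable (S * T)%type.
Proof.
move=> [B cB [oB nB]] [C cC [oC nC]].
exists ((fun UV => UV.1 `*` UV.2) @` (B `*` C)).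
  by apply: sub_countable (card_image_le _ _) _; exact: countableX.
split=> [_ [[U V] [/= BU CV] <-]|[a b] W [[P Q] /= [aP bQ] sW]].
  by apply: openX; [exact: oB | exact: oC].
have [U [BU Ua] UP] := nB a P aP; have [V [CV Vb] VQ] := nC b Q bQ.
exists (U `*` V); first by split; [exists (U, V) | split].
by move=> [x y] [/UP Px /VQ Qy]; apply: sW.
Qed.

Lemma row_continuous (R : realType) n (T : topologicalType)
    (F : T -> 'rV[R]_n) x :
  (forall j, {for x, continuous (fun z => F z 0 j)}) ->
  {for x, continuous F}.
Proof.
move=> cF A [P nP sA].
have : \forall z \near x, forall j, P 0 j (F z 0 j).
  by apply: filter_forall => j; exact: (cF j _ (nP 0 j)).
by apply: filterS => z Pz; apply: sA => i j; rewrite (ord1 i).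
Qed.

End ProductTopology.

Section Product.
Variables (R : realType) (p q : nat) (M1 : manifold R p) (M2 : manifold R q).

Local Notation pchart := (chart M1 * chart M2)%type.

Definition pcdom (c : pchart) : set (M1 * M2) := cdom c.1 `*` cdom c.2.
Definition pcmap (c : pchart) (x : M1 * M2) : 'rV[R]_(p + q) :=
  row_mx (cmap c.1 x.1) (cmap c.2 x.2).
Definition pcinv (c : pchart) (y : 'rV[R]_(p + q)) : M1 * M2 :=
  (cinv c.1 (lsubmx y), cinv c.2 (rsubmx y)).

Lemma pcdom_open c : open (pcdom c).
Proof. by apply: openX; exact: cdom_open. Qed.

Lemma pcdom_cover x : exists c, pcdom c x.
Proof.
have [c1 ?] := cdom_cover x.1; have [c2 ?] := cdom_cover x.2.
by exists (c1, c2).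
Qed.

Lemma pcimgE c : pcmap c @` pcdom c =
  lsubmx @^-1` cimg c.1 `&` rsubmx @^-1` cimg c.2.
Proof.
apply/seteqP; split => [_ [x [x1 x2] <-]|y [[x1 d1 e1] [x2 d2 e2]]].
  by rewrite /= row_mxKl row_mxKr; split; [exists x.1 | exists x.2].
by exists (x1, x2) => //=; rewrite /pcmap /= e1 e2 hsubmxK.
Qed.

Lemma pcimg_open c : open (pcmap c @` pcdom c).
Proof.
rewrite pcimgE; apply: openI; apply: open_comp.
- by move=> y _; exact: continuous_lsubmx.
- exact: cimg_open.
- by move=> y _; exact: continuous_rsubmx.
- exact: cimg_open.
Qed.

Lemma pcmapK c x : pcdom c x -> pcinv c (pcmap c x) = x.
Proof.
case: x => x1 x2 [/= d1 d2].
by rewrite /pcinv /pcmap /= row_mxKl row_mxKr !cmapK.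
Qed.

Lemma pcmap_continuous c x : pcdom c x -> {for x, continuous (pcmap c)}.
Proof.
case=> d1 d2; apply: row_continuous => j.
case: (splitP j) => k jk.
  have -> : j = lshift q k by apply/val_inj.
  rewrite (_ : (fun z => _) = (fun v => v 0 k) \o cmap c.1 \o fst); last first.
    by apply/funext => z /=; rewrite row_mxEl.
  apply: continuous_comp; first exact: cvg_fst.
  apply: (@continuous_comp _ _ _ (cmap c.1) (fun v => v 0 k)).
    exact: cmap_continuous.
  exact: coord_continuous.
have -> : j = rshift p k by apply/val_inj.
rewrite (_ : (fun z => _) = (fun v => v 0 k) \o cmap c.2 \o snd); last first.
  by apply/funext => z /=; rewrite row_mxEr.
apply: continuous_comp; first exact: cvg_snd.
apply: (@continuous_comp _ _ _ (cmap c.2) (fun v => v 0 k)).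
  exact: cmap_continuous.
exact: coord_continuous.
Qed.

Lemma pcinv_continuous c y : (pcmap c @` pcdom c) y ->
  {for y, continuous (pcinv c)}.
Proof.
rewrite pcimgE => -[i1 i2].
have h1 : {for y, continuous (cinv c.1 \o lsubmx)}.
  apply: continuous_comp; first exact: continuous_lsubmx.
  exact: cinv_continuous.
have h2 : {for y, continuous (cinv c.2 \o rsubmx)}.
  apply: continuous_comp; first exact: continuous_rsubmx.
  exact: cinv_continuous.
exact: cvg_pair h1 h2.
Qed.

Lemma poverlap c d : pcmap c @` (pcdom c `&` pcdom d) `<=`
  lsubmx @^-1` overlap c.1 d.1 `&` rsubmx @^-1` overlap c.2 d.2.
Proof.
move=> _ [x [[c1 c2] [d1 d2]] <-]; rewrite /= row_mxKl row_mxKr.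
by split; [exists x.1 | exists x.2].
Qed.

Lemma ptransition_smooth c d (a : 'I_(p + q)) :
  smooth_on (pcmap c @` (pcdom c `&` pcdom d))
    (fun y => pcmap d (pcinv c y) 0 a).
Proof.
case: (splitP a) => k ak.
  have -> : a = lshift q k by apply/val_inj.
  apply: (smooth_on_lsubmx (@transition_smooth _ _ _ c.1 d.1 k)).
    by move=> y /poverlap[].
  by apply/funext => y; rewrite /pcmap row_mxEl.
have -> : a = rshift p k by apply/val_inj.
apply: (smooth_on_rsubmx (@transition_smooth _ _ _ c.2 d.2 k)).
  by move=> y /poverlap[].
by apply/funext => y; rewrite /pcmap row_mxEr.
Qed.

Definition prod_manifold : manifold R (p + q) :=
  @Manifold R (p + q) (M1 * M2)%type
    (hausdorff_prod (@mspace_hausdorff _ _ M1) (@mspace_hausdorff _ _ M2))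
    (second_countable_prod (@mspace_countable _ _ M1)
                           (@mspace_countable _ _ M2))
    pchart pcdom pcmap pcinv pcdom_open pcdom_cover pcimg_open pcmapK
    pcmap_continuous pcinv_continuous ptransition_smooth.

Variables (g1 : metric M1) (g2 : metric M2).

Definition pgcomp (c : chart prod_manifold) (y : 'rV[R]_(p + q)) :
    'M[R]_(p + q) :=
  block_mx (gcomp g1 c.1 (lsubmx y)) 0 0 (gcomp g2 c.2 (rsubmx y)).

Lemma pcimgP (c : chart prod_manifold) y : cimg c y ->
  cimg c.1 (lsubmx y) /\ cimg c.2 (rsubmx y).
Proof. by move=> cy; have := cy; rewrite [cimg c](pcimgE c). Qed.

Lemma pgcomp_smooth c i j : smooth_on (cimg c) (fun y => pgcomp c y i j).
Proof.
case: (splitP i) => k ik; case: (splitP j) => l jl.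
- have -> : i = lshift q k by apply/val_inj.
  have -> : j = lshift q l by apply/val_inj.
  apply: (smooth_on_lsubmx (@gcomp_smooth _ _ _ g1 c.1 k l)).
    by move=> y /pcimgP[].
  by apply/funext => y; rewrite /pgcomp block_mxEul.
- have -> : i = lshift q k by apply/val_inj.
  have -> : j = rshift p l by apply/val_inj.
  rewrite (_ : (fun y => _) = cst 0); first exact: smooth_on0.
  by apply/funext => y; rewrite /pgcomp block_mxEur mxE.
- have -> : i = rshift p k by apply/val_inj.
  have -> : j = lshift q l by apply/val_inj.
  rewrite (_ : (fun y => _) = cst 0); first exact: smooth_on0.
  by apply/funext => y; rewrite /pgcomp block_mxEdl mxE.
- have -> : i = rshift p k by apply/val_inj.
  have -> : j = rshift p l by apply/val_inj.
  apply: (smooth_on_rsubmx (@gcomp_smooth _ _ _ g2 c.2 k l)).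
    by move=> y /pcimgP[].
  by apply/funext => y; rewrite /pgcomp block_mxEdr.
Qed.

Lemma pgcomp_sym c y : cimg c y -> (pgcomp c y)^T = pgcomp c y.
Proof.
by move=> /pcimgP[i1 i2]; rewrite /pgcomp tr_block_mx !trmx0 !gcomp_sym.
Qed.

Lemma pgcomp_unit c y : cimg c y -> pgcomp c y \in unitmx.
Proof.
move=> /pcimgP[i1 i2]; rewrite unitmxE det_ublock unitrM -!unitmxE.
by rewrite !gcomp_unit.
Qed.

Lemma pgcomp_signature : exists s : 'I_(p + q) -> bool,
  forall c y, cimg c y -> exists2 P : 'M[R]_(p + q), P \in unitmx &
    P *m pgcomp c y *m P^T = diag_mx (\row_i (-1) ^+ s i).
Proof.
have [s1 h1] := gcomp_signature g1; have [s2 h2] := gcomp_signature g2.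
exists (fun i => match fintype.split i with inl a => s1 a | inr b => s2 b end).
move=> c y /pcimgP[/h1[P1 u1 e1] /h2[P2 u2 e2]].
exists (block_mx P1 0 0 P2).
  by rewrite unitmxE det_ublock unitrM -!unitmxE u1 u2.
rewrite /pgcomp tr_block_mx !trmx0 !mulmx_block.
rewrite !(mul0mx, mulmx0, addr0, add0r) e1 e2.
rewrite (_ : (\row_i _) = row_mx (\row_i (-1) ^+ s1 i) (\row_i (-1) ^+ s2 i)).
  by rewrite diag_mx_row.
apply/rowP => i; rewrite mxE; case: (splitP i) => k ik.
  by have -> : i = lshift q k by [apply/val_inj]; rewrite row_mxEl mxE.
by have -> : i = rshift p k by [apply/val_inj]; rewrite row_mxEr mxE.
Qed.

Lemma ptransitionE (c d : chart prod_manifold) :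
  transition c d = (fun z => row_mx (transition c.1 d.1 (lsubmx z))
                                    (transition c.2 d.2 (rsubmx z))).
Proof. by []. Qed.

Lemma pgcomp_transition c d y : overlap c d y ->
  pgcomp c y = jac (transition c d) y *m pgcomp d (transition c d y)
               *m (jac (transition c d) y)^T.
Proof.
move=> /poverlap[o1 o2]; rewrite ptransitionE jac_prod /pgcomp.
rewrite row_mxKl row_mxKr tr_block_mx !trmx0 !mulmx_block.
by rewrite !(mul0mx, mulmx0, addr0, add0r) -!gcomp_transition.
Qed.

Definition prod_metric : metric prod_manifold :=
  Metric pgcomp_smooth pgcomp_sym pgcomp_unit pgcomp_signature pgcomp_transition.

Local Notation M := prod_manifold.

(* Pullbacks to the product along the two projections: the component is zero
   unless all the indices belong to the factor. *)
Definition pullback1 I J (u : I -> option J)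
    (T : chart M1 -> 'rV[R]_p -> J -> R) :
    chart M -> 'rV[R]_(p + q) -> I -> R :=
  fun c y i => oapp (T c.1 (lsubmx y)) 0 (u i).

Definition pullback2 I J (u : I -> option J)
    (T : chart M2 -> 'rV[R]_q -> J -> R) :
    chart M -> 'rV[R]_(p + q) -> I -> R :=
  fun c y i => oapp (T c.2 (rsubmx y)) 0 (u i).

Definition opair I I' J J' (u : I -> option J) (v : I' -> option J')
    (ij : I * I') : option (J * J') :=
  if (u ij.1, v ij.2) is (Some a, Some b) then Some (a, b) else None.

Definition opair2 m n (u : 'I_n -> option 'I_m) : idx2 n -> option (idx2 m) :=
  opair u u.

Definition opair4 m n (u : 'I_n -> option 'I_m) : idx4 n -> option (idx4 m) :=
  opair (opair (opair u u) u) u.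

Definition base_metric := pullback1 (opair2 (@lidx p q)) (metric_tensor g1).
Definition base_riemann := pullback1 (opair4 (@lidx p q)) (riemann g1).
Definition base_ricci := pullback1 (opair2 (@lidx p q)) (ricci g1).
Definition base_nabla_riemann :=
  pullback1 (opair (@lidx p q) (opair4 (@lidx p q))) (nabla_riemann g1).

Definition fibre_metric := pullback2 (opair2 (@ridx p q)) (metric_tensor g2).
Definition fibre_riemann := pullback2 (opair4 (@ridx p q)) (riemann g2).
Definition fibre_ricci := pullback2 (opair2 (@ridx p q)) (ricci g2).
Definition fibre_nabla_riemann :=
  pullback2 (opair (@ridx p q) (opair4 (@ridx p q))) (nabla_riemann g2).

(* Parts of a 1-form of the product; their components remain functions on the
   whole product. *)
Definition base_part (w : one_form M) :
    chart M -> 'rV[R]_(p + q) -> 'I_(p + q) -> R :=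
  fun c y i => if lidx i is Some _ then wcomp w c y 0 i else 0.

Definition fibre_part (w : one_form M) :
    chart M -> 'rV[R]_(p + q) -> 'I_(p + q) -> R :=
  fun c y i => if ridx i is Some _ then wcomp w c y 0 i else 0.

End Product.

Arguments base_metric {R p q M1} M2 g1.
Arguments fibre_metric {R p q} M1 {M2} g2.
Arguments base_riemann {R p q M1} M2 g1.
Arguments fibre_riemann {R p q} M1 {M2} g2.
Arguments base_ricci {R p q M1} M2 g1.
Arguments fibre_ricci {R p q} M1 {M2} g2.
Arguments base_nabla_riemann {R p q M1} M2 g1.
Arguments fibre_nabla_riemann {R p q} M1 {M2} g2.

(* Main.v *)
(* In product charts the metric is block diagonal, so the Christoffel symbols,
   R, S and nabla R are the sums of the pullbacks of those of the factors: every
   component with both base and fibre indices vanishes.  Hence the defining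
   equation splits according to the position of its curvature indices.  All in
   the base (or all in the fibre): 1 and 2, with (i) or (ii) according to the
   differentiation index.  Two in each: the left-hand side and R vanish, while
   the Kulkarni-Nomizu products leave products of a base and a fibre tensor,
   which gives 3. *)

Require Import Defs.
From mathcomp Require Import all_boot all_order all_algebra.
From mathcomp Require Import lra.
From mathcomp Require Import all_classical all_reals.
From mathcomp Require Import topology normedtype derive.

Set Implicit Arguments.
Unset Strict Implicit.
Unset Printing Implicit Defensive.

Import Order.TTheory GRing.Theory Num.Theory.
Import numFieldNormedType.Exports.

Local Open Scope classical_set_scope.
Local Open Scope ring_scope.

(** * Coordinate formulas for connection, curvature, trace and covariant derivative *)

Section Algebra.
Variables (R : fieldType) (n : nat).
Implicit Types (h : idx2 n -> R) (G : 'I_n * 'I_n * 'I_n -> R).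

(** Here [h] stands for the inverse metric and [D] for the first derivatives of the metric. Taking
    derivatives as an independent array makes the splitting over a product a matter of finite sums
    only. *)
Definition koszul h (D : 'I_n * idx2 n -> R) : 'I_n * 'I_n * 'I_n -> R :=
  fun '(i, j, k) =>
    2^-1 * \sum_l h (k, l) * (D (i, (j, l)) + D (j, (i, l)) - D (l, (i, j))).

Definition curvature (D : 'I_n * ('I_n * 'I_n * 'I_n) -> R) G h : idx4 n -> R :=
  fun '(i, j, k, l) =>
    \sum_s (D (j, (i, k, s)) - D (i, (j, k, s))
            + \sum_t (G (j, t, s) * G (i, k, t) - G (i, t, s) * G (j, k, t)))
           * h (s, l).

Definition metric_trace h (A : idx4 n -> R) : idx2 n -> R :=
  fun '(j, k) => \sum_i \sum_l h (i, l) * A (i, j, k, l).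

Definition cov_derivative (D : 'I_n * idx4 n -> R) G (A : idx4 n -> R) :
    'I_n * idx4 n -> R :=
  fun '(m, (i, j, k, l)) => D (m, (i, j, k, l))
    - \sum_s (G (m, i, s) * A (s, j, k, l) + G (m, j, s) * A (i, s, k, l)
              + G (m, k, s) * A (i, j, s, l) + G (m, l, s) * A (i, j, k, s)).

End Algebra.

(** * Compatibility of these formulas with block decompositions *)

Section BlockSum.
Variables (R : fieldType) (p q : nat).
Local Notation l1 := (@lidx p q).
Local Notation r1 := (@ridx p q).
Local Notation l2 := (opair2 l1).
Local Notation r2 := (opair2 r1).
Local Notation l3 := (opair (opair l1 l1) l1).
Local Notation r3 := (opair (opair r1 r1) r1).
Local Notation l4 := (opair4 l1).
Local Notation r4 := (opair4 r1).

(** With [u] and [v] reading a multi-index of the product in the base and in the fibre, this is the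
    sum of two pullbacks; a mixed multi-index is read by neither and gives 0. *)
Definition block_sum I J J' (u : I -> option J) (v : I -> option J')
    (a : J -> R) (b : J' -> R) (i : I) : R :=
  oapp a 0 (u i) + oapp b 0 (v i).

Let idxE := (lidx_lshift, lidx_rshift, ridx_lshift, ridx_rshift).
Let zeroE := (mul0r, mulr0, addr0, add0r, subr0, sub0r, oppr0).

(** The sum over [l] is cut into its base and fibre ranges. In the range opposite to [k] the factor
    [h (k, l)] vanishes; in the other range the derivatives vanish unless [i] and [j] lie in the
    same block. *)
Lemma koszul_block_sum h1 h2 D1 D2 :
  koszul (block_sum l2 r2 h1 h2) (block_sum (opair l1 l2) (opair r1 r2) D1 D2)
  =1 block_sum l3 r3 (koszul h1 D1) (koszul h2 D2).
Proof.
move=> [[i j] k]; rewrite /koszul big_split_ord /block_sum /opair2 /opair /=.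
case: (split_ordP i) => ? ->; case: (split_ordP j) => ? ->;
case: (split_ordP k) => ? ->.
all: under eq_bigr do rewrite ?idxE /= ?zeroE.
all: under [X in _ + X]eq_bigr do rewrite ?idxE /= ?zeroE.
all: by rewrite !idxE /= ?big1_eq ?zeroE.
Qed.

(** The summation indices [s] and [t] chain the factors of each product together, so a nonzero
    product forces all of [i], [j], [k], [l], [s], [t] into one block. *)
Lemma curvature_block_sum D1 D2 G1 G2 h1 h2 :
  curvature (block_sum (opair l1 l3) (opair r1 r3) D1 D2)
    (block_sum l3 r3 G1 G2) (block_sum l2 r2 h1 h2)
  =1 block_sum l4 r4 (curvature D1 G1 h1) (curvature D2 G2 h2).
Proof.
move=> [[[i j] k] l]; rewrite /curvature big_split_ord.
under eq_bigr do rewrite big_split_ord.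
under [X in _ + X = _]eq_bigr do rewrite big_split_ord.
rewrite /block_sum /opair4 /opair2 /opair /=.
case: (split_ordP i) => ? ->; case: (split_ordP j) => ? ->;
case: (split_ordP k) => ? ->; case: (split_ordP l) => ? ->.
all: under eq_bigr do
  (under eq_bigr do rewrite ?idxE /= ?zeroE;
   under [X in _ + (_ + X)]eq_bigr do rewrite ?idxE /= ?zeroE;
   rewrite ?idxE /= ?big1_eq ?zeroE).
all: under [X in _ + X]eq_bigr do
  (under eq_bigr do rewrite ?idxE /= ?zeroE;
   under [X in _ + (_ + X)]eq_bigr do rewrite ?idxE /= ?zeroE;
   rewrite ?idxE /= ?big1_eq ?zeroE).
all: by rewrite !idxE /= ?big1_eq ?zeroE.
Qed.

Lemma metric_trace_block_sum h1 h2 A1 A2 :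
  metric_trace (block_sum l2 r2 h1 h2) (block_sum l4 r4 A1 A2)
  =1 block_sum l2 r2 (metric_trace h1 A1) (metric_trace h2 A2).
Proof.
move=> [j k]; rewrite /metric_trace big_split_ord.
under eq_bigr do rewrite big_split_ord.
under [X in _ + X = _]eq_bigr do rewrite big_split_ord.
rewrite /block_sum /opair4 /opair2 /opair /=.
case: (split_ordP j) => ? ->; case: (split_ordP k) => ? ->.
all: under eq_bigr do
  (under eq_bigr do rewrite ?idxE /= ?zeroE;
   under [X in _ + X]eq_bigr do rewrite ?idxE /= ?zeroE;
   rewrite ?big1_eq ?zeroE).
all: under [X in _ + X]eq_bigr do
  (under eq_bigr do rewrite ?idxE /= ?zeroE;
   under [X in _ + X]eq_bigr do rewrite ?idxE /= ?zeroE;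
   rewrite ?big1_eq ?zeroE).
all: by rewrite !idxE /= ?big1_eq ?zeroE.
Qed.

(** Each correction term replaces one index of [A] by [s]; its Christoffel factor ties [s] to [m]
    and to the replaced index, and [A] ties [s] to the remaining ones. *)
Lemma cov_derivative_block_sum D1 D2 G1 G2 A1 A2 :
  cov_derivative (block_sum (opair l1 l4) (opair r1 r4) D1 D2)
    (block_sum l3 r3 G1 G2) (block_sum l4 r4 A1 A2)
  =1 block_sum (opair l1 l4) (opair r1 r4)
       (cov_derivative D1 G1 A1) (cov_derivative D2 G2 A2).
Proof.
move=> [m [[[i j] k] l]]; rewrite /cov_derivative big_split_ord.
rewrite /block_sum /opair4 /opair /=.
case: (split_ordP m) => ? ->; case: (split_ordP i) => ? ->;
case: (split_ordP j) => ? ->; case: (split_ordP k) => ? ->;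
case: (split_ordP l) => ? ->.
all: under eq_bigr do rewrite ?idxE /= ?zeroE.
all: under [X in _ - (_ + X)]eq_bigr do rewrite ?idxE /= ?zeroE.
all: by rewrite !idxE /= ?big1_eq ?zeroE.
Qed.

End BlockSum.

(** * The geometric tensors of a metric in terms of the algebraic formulas *)

Section AnyMetric.
Variables (R : realType) (n : nat) (M : manifold R n).

Definition gradient I (T : chart M -> 'rV[R]_n -> I -> R) :
    chart M -> 'rV[R]_n -> 'I_n * I -> R :=
  fun c y mi => pd mi.1 (fun z => T c z mi.2) y.

(** The block forms of Christoffel symbols and curvature are established on the chart image; since
    that image is open, they may be differentiated there. *)
Lemma pd_eq_on (c : chart M) (f h : 'rV[R]_n -> R) i y : cimg c y ->
  (forall z, cimg c z -> f z = h z) -> pd i f y = pd i h y.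
Proof.
move=> cy fh; apply: near_eq_derive; have : nbhs y (cimg c).
  by apply: open_nbhs_nbhs; split => //; exact: cimg_open.
by apply: filterS => z /fh.
Qed.

Variable g : metric M.

Definition christoffel_symbols :
    chart M -> 'rV[R]_n -> 'I_n * 'I_n * 'I_n -> R :=
  fun c y '(i, j, k) => christoffel g c i j k y.

Definition inverse_metric : chart M -> 'rV[R]_n -> idx2 n -> R :=
  fun c y '(i, j) => invmx (gcomp g c y) i j.

Variable c : chart M.

(** Coordinate fields have constant components, so only the term [t = k] of the connection sum
    survives. An equality of functions is stated because the curvature differentiates it once
    more. *)
Lemma cov_coord_field i k :
  cov g c i (coord_field k) = fun y => \row_s christoffel g c i k s y.
Proof.
apply/funext => y; apply/rowP => s; rewrite !mxE /coord_field.
rewrite (_ : pd _ _ _ = 0) ?add0r; last exact: derive_cst.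
rewrite (bigD1 k) //= big1 ?addr0 => [|t tk]; rewrite mxE /= ?eqxx ?mulr1 //.
by rewrite (negbTE tk) mulr0.
Qed.

Lemma christoffelE y : christoffel_symbols c y =1
  koszul (inverse_metric c y) (gradient (metric_tensor g) c y).
Proof. by move=> [[i j] k]. Qed.

Lemma riemannE y : riemann g c y =1
  curvature (gradient christoffel_symbols c y) (christoffel_symbols c y)
    (metric_tensor g c y).
Proof.
move=> [[[i j] k] l].
rewrite /= /riemann_comp !cov_coord_field mxE; apply: eq_bigr => s _.
congr (_ * _); rewrite !mxE sumrB /gradient /=.
have E a b : (fun z => (\row_s christoffel g c a b s z) 0 s)
    = (fun z => christoffel g c a b s z) by apply/funext => z; rewrite mxE.
rewrite !E; under eq_bigr do rewrite mxE.
under [X in _ - (_ + X)]eq_bigr do rewrite mxE.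
by rewrite opprD addrACA.
Qed.

Lemma nabla_riemannE y : nabla_riemann g c y =1
  cov_derivative (gradient (riemann g) c y) (christoffel_symbols c y)
    (riemann g c y).
Proof. by move=> [m [[[i j] k] l]]. Qed.

Lemma ricciE y :
  ricci g c y =1 metric_trace (inverse_metric c y) (riemann g c y).
Proof. by move=> [j k]. Qed.

End AnyMetric.

(** * Splitting of the tensors of a product metric *)

Section ProductGeometry.
Variables (R : realType) (p q : nat) (M1 : manifold R p) (M2 : manifold R q).
Local Notation M := (prod_manifold M1 M2).
Local Notation l1 := (@lidx p q).
Local Notation r1 := (@ridx p q).
Local Notation l2 := (opair2 l1).
Local Notation r2 := (opair2 r1).
Local Notation l3 := (opair (opair l1 l1) l1).
Local Notation r3 := (opair (opair r1 r1) r1).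
Local Notation l4 := (opair4 l1).
Local Notation r4 := (opair4 r1).

(** A multi-index may well lie in neither factor; only lying in both is excluded. *)
Definition disjoint_idx I J J' (u : I -> option J) (v : I -> option J') :=
  forall i, u i = None \/ v i = None.

Lemma disjoint_lridx : disjoint_idx l1 r1.
Proof.
move=> i; case: (split_ordP i) => a ->.
  by right; rewrite ridx_lshift.
by left; rewrite lidx_rshift.
Qed.

(** A tuple leaves a factor as soon as one entry does, so disjointness passes from the leading index
    to longer multi-indices. *)
Lemma disjoint_opair I I' J J' K K' (u : I -> option J) (v : I -> option J')
    (u' : I' -> option K) (v' : I' -> option K') :
  disjoint_idx u v -> disjoint_idx (opair u u') (opair v v').
Proof.
by move=> uv [i i']; case: (uv i) => /= e; [left|right]; rewrite /opair /= e.
Qed.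

(** The projection sends a coordinate vector to a coordinate vector or to 0, so the difference
    quotients of a pullback are those on the base, or vanish in fibre directions. *)
Lemma gradient_pullback1 I J (u : I -> option J)
    (T : chart M1 -> 'rV[R]_p -> J -> R) :
  gradient (pullback1 (M2 := M2) u T) = pullback1 (opair l1 u) (gradient T).
Proof.
apply/funext => c; apply/funext => y; apply/funext => -[m i].
rewrite /gradient /pullback1 /opair /=; case: (u i) => [j|] /=.
  rewrite (pd_comp (@lsubmx_delta R p q) m (fun z => T c.1 z j)).
  by case: (lidx m).
by case: (lidx m) => [?|]; exact: derive_cst.
Qed.

Lemma gradient_pullback2 I J (u : I -> option J)
    (T : chart M2 -> 'rV[R]_q -> J -> R) :
  gradient (pullback2 (M1 := M1) u T) = pullback2 (opair r1 u) (gradient T).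
Proof.
apply/funext => c; apply/funext => y; apply/funext => -[m i].
rewrite /gradient /pullback2 /opair /=; case: (u i) => [j|] /=.
  rewrite (pd_comp (@rsubmx_delta R p q) m (fun z => T c.2 z j)).
  by case: (ridx m).
by case: (ridx m) => [?|]; exact: derive_cst.
Qed.

(* Disjointness spares any differentiability assumption: of the two summands
   at most one is not identically zero. *)
Lemma gradient_block_sum I J J' (u : I -> option J) (v : I -> option J')
    (T : chart M -> 'rV[R]_(p + q) -> I -> R)
    (T1 : chart M1 -> 'rV[R]_p -> J -> R)
    (T2 : chart M2 -> 'rV[R]_q -> J' -> R) c :
  disjoint_idx u v ->
  (forall y, cimg c y ->
     T c y = block_sum u v (T1 c.1 (lsubmx y)) (T2 c.2 (rsubmx y))) ->
  forall y, cimg c y -> gradient T c y =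
    block_sum (opair l1 u) (opair r1 v)
      (gradient T1 c.1 (lsubmx y)) (gradient T2 c.2 (rsubmx y)).
Proof.
move=> uv TE y cy; apply/funext => -[m i].
have /(congr1 (fun F => F c y (m, i))) E1 := gradient_pullback1 u T1.
have /(congr1 (fun F => F c y (m, i))) E2 := gradient_pullback2 v T2.
rewrite /block_sum -[X in X + _]E1 -[X in _ + X]E2.
rewrite {1}/gradient /=; case: (uv i) => e.
  rewrite (@pd_eq_on _ _ M c _ (fun z => pullback2 (M1 := M1) v T2 c z i)) //.
    rewrite [X in X + _](_ : _ = 0) ?add0r // /gradient /pullback1 /= e.
    exact: derive_cst.
  by move=> z cz; rewrite TE // /block_sum e add0r.
rewrite (@pd_eq_on _ _ M c _ (fun z => pullback1 (M2 := M2) u T1 c z i)) //.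
  rewrite [X in _ + X](_ : _ = 0) ?addr0 // /gradient /pullback2 /= e.
  exact: derive_cst.
by move=> z cz; rewrite TE // /block_sum e addr0.
Qed.

Variables (g1 : metric M1) (g2 : metric M2) (c : chart M).
Local Notation g := (prod_metric g1 g2).

Lemma metric_tensor_prod y : metric_tensor g c y =
  block_sum l2 r2 (metric_tensor g1 c.1 (lsubmx y))
                  (metric_tensor g2 c.2 (rsubmx y)).
Proof.
apply/funext => -[i j]; rewrite /block_sum /opair2 /opair /= /pgcomp.
case: (split_ordP i) => a ->; case: (split_ordP j) => b ->;
  rewrite ?lidx_lshift ?lidx_rshift ?ridx_lshift ?ridx_rshift /=;
  by rewrite ?block_mxEul ?block_mxEur ?block_mxEdl ?block_mxEdr ?mxE ?addr0 ?add0r.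
Qed.

Lemma invmx_gcomp_prod y : cimg c y -> invmx (gcomp g c y) =
  block_mx (invmx (gcomp g1 c.1 (lsubmx y))) 0
           0 (invmx (gcomp g2 c.2 (rsubmx y))).
Proof.
move=> cy; have [/(gcomp_unit g1) u1 /(gcomp_unit g2) u2] := pcimgP cy.
have ug := gcomp_unit g cy.
(* Left multiplication by the invertible [g] is injective, so it suffices that the block matrix is a
   right inverse. *)
apply: (can_inj (mulKmx ug)); rewrite mulmxV //= /pgcomp mulmx_block.
by rewrite !(mulmx0, mul0mx, addr0, add0r) !mulmxV // -scalar_mx_block.
Qed.

Lemma inverse_metric_prod y : cimg c y -> inverse_metric g c y =
  block_sum l2 r2 (inverse_metric g1 c.1 (lsubmx y))
                  (inverse_metric g2 c.2 (rsubmx y)).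
Proof.
move=> cy; apply/funext => -[i j].
rewrite /inverse_metric invmx_gcomp_prod // /block_sum /opair2 /opair /=.
case: (split_ordP i) => a ->; case: (split_ordP j) => b ->;
  rewrite ?lidx_lshift ?lidx_rshift ?ridx_lshift ?ridx_rshift /=;
  by rewrite ?block_mxEul ?block_mxEur ?block_mxEdl ?block_mxEdr ?mxE ?addr0 ?add0r.
Qed.

Lemma christoffel_prod y : cimg c y -> christoffel_symbols g c y =
  block_sum l3 r3 (christoffel_symbols g1 c.1 (lsubmx y))
                  (christoffel_symbols g2 c.2 (rsubmx y)).
Proof.
move=> cy; rewrite !(funext (christoffelE _ _ _)) inverse_metric_prod //.
rewrite (gradient_block_sum _ (fun y _ => metric_tensor_prod y) cy).
  exact/funext/koszul_block_sum.
exact/disjoint_opair/disjoint_lridx.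
Qed.

Lemma riemann_prod y : cimg c y -> riemann g c y =
  block_sum l4 r4 (riemann g1 c.1 (lsubmx y)) (riemann g2 c.2 (rsubmx y)).
Proof.
move=> cy; rewrite !(funext (riemannE _ _ _)) metric_tensor_prod.
(* The block form of the Christoffel symbols is used twice: at [y], and on the whole chart image for
   their derivatives. *)
rewrite christoffel_prod // (gradient_block_sum _ christoffel_prod cy).
  exact/funext/curvature_block_sum.
exact/disjoint_opair/disjoint_opair/disjoint_lridx.
Qed.

Lemma ricci_prod y : cimg c y -> ricci g c y =
  block_sum l2 r2 (ricci g1 c.1 (lsubmx y)) (ricci g2 c.2 (rsubmx y)).
Proof.
move=> cy; rewrite !(funext (ricciE _ _ _)) inverse_metric_prod //.
rewrite riemann_prod //; exact/funext/metric_trace_block_sum.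
Qed.

Lemma nabla_riemann_prod y : cimg c y -> nabla_riemann g c y =
  block_sum (opair l1 l4) (opair r1 r4)
    (nabla_riemann g1 c.1 (lsubmx y)) (nabla_riemann g2 c.2 (rsubmx y)).
Proof.
move=> cy; rewrite !(funext (nabla_riemannE _ _ _)) christoffel_prod //.
rewrite riemann_prod // (gradient_block_sum _ riemann_prod cy).
  exact/funext/cov_derivative_block_sum.
exact/disjoint_opair/disjoint_opair/disjoint_opair/disjoint_lridx.
Qed.

End ProductGeometry.

(** * Splitting of the recurrence equation at one point *)

Section SuperGeneralizedRecurrence.
Variables (R : realFieldType) (p q : nat).
Local Notation l1 := (@lidx p q).
Local Notation r1 := (@ridx p q).
Local Notation l2 := (opair2 l1).
Local Notation r2 := (opair2 r1).
Local Notation l4 := (opair4 l1).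
Local Notation r4 := (opair4 r1).

Definition extend0 I J (u : I -> option J) (a : J -> R) (i : I) : R :=
  oapp a 0 (u i).

(** Only membership of the index in the factor is tested: unlike in [extend0], the value is still
    that of a form on the product. *)
Definition form_part n m (u : 'I_n -> option 'I_m) (w : 'I_n -> R) (i : 'I_n) : R :=
  if u i is Some _ then w i else 0.

Definition kulkarni_nomizu n (A E : idx2 n -> R) : idx4 n -> R :=
  fun '(i, j, k, l) => A (i, l) * E (j, k) + A (j, k) * E (i, l)
                       - A (i, k) * E (j, l) - A (j, l) * E (i, k).
Local Notation "A # E" := (kulkarni_nomizu A E) (at level 40).

Definition sgk_rhs n (Pi Phi Psi Theta : 'I_n -> R) (A : idx4 n -> R)
    (S h : idx2 n -> R) (mi : 'I_n * idx4 n) : R :=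
  Pi mi.1 * A mi.2 + Phi mi.1 * (S # S) mi.2 + Psi mi.1 * (h # S) mi.2
  + Theta mi.1 * (h # h) mi.2.

Definition transverse_condition n (Pi Phi Psi Theta : 'I_n -> R)
    (A : idx4 n -> R) (S h : idx2 n -> R) : Prop :=
  forall mi : 'I_n * idx4 n, - Pi mi.1 * A mi.2 =
    Phi mi.1 * (S # S) mi.2 + Psi mi.1 * (h # S) mi.2 + Theta mi.1 * (h # h) mi.2.

(** The multi-index is grouped as [m], [(i, l)], [(j, k)], following the positive terms of the
    Kulkarni-Nomizu product. *)
Definition mixed_condition n m m' (u : 'I_n -> option 'I_m)
    (v : 'I_n -> option 'I_m') (Phi Psi Theta : 'I_n -> R)
    (S h : idx2 m -> R) (S' h' : idx2 m' -> R) : Prop :=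
  forall mijkl : 'I_n * idx2 n * idx2 n,
    ((form_part u Phi mijkl.1.1 * extend0 (opair2 u) S mijkl.1.2) *+ 2
     + form_part u Psi mijkl.1.1 * extend0 (opair2 u) h mijkl.1.2)
    * extend0 (opair2 v) S' mijkl.2
    = - (form_part u Psi mijkl.1.1 * extend0 (opair2 u) S mijkl.1.2
         + (form_part u Theta mijkl.1.1 * extend0 (opair2 u) h mijkl.1.2) *+ 2)
      * extend0 (opair2 v) h' mijkl.2.

Let idxE := (lidx_lshift, lidx_rshift, ridx_lshift, ridx_rshift).
Let zeroE := (mul0r, mulr0, addr0, add0r, subr0, sub0r, oppr0, mul0rn).

Definition sgk_splitting (Pi Phi Psi Theta : 'I_(p + q) -> R) N1 N2 A1 A2
    S1 S2 h1 h2 : Prop :=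
  let base w := form_part l1 w in let fibre w := form_part r1 w in
  ((extend0 (opair l1 l4) N1 =1
      sgk_rhs (base Pi) (base Phi) (base Psi) (base Theta)
        (extend0 l4 A1) (extend0 l2 S1) (extend0 l2 h1)) /\
   transverse_condition (fibre Pi) (fibre Phi) (fibre Psi) (fibre Theta)
     (extend0 l4 A1) (extend0 l2 S1) (extend0 l2 h1)) /\
  ((extend0 (opair r1 r4) N2 =1
      sgk_rhs (fibre Pi) (fibre Phi) (fibre Psi) (fibre Theta)
        (extend0 r4 A2) (extend0 r2 S2) (extend0 r2 h2)) /\
   transverse_condition (base Pi) (base Phi) (base Psi) (base Theta)
     (extend0 r4 A2) (extend0 r2 S2) (extend0 r2 h2)) /\
  (mixed_condition l1 r1 Phi Psi Theta S1 h1 S2 h2 /\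
   mixed_condition r1 l1 Phi Psi Theta S2 h2 S1 h1).

(** With [i], [l] in one factor and [j], [k] in the other, the negative terms of the products vanish
    and the equation reads 0 = 2 Phi S S' + Psi (h S' + S h') + 2 Theta h h', which is the mixed
    condition multiplied out. With [i], [k] against [j], [l] the same expression appears with the
    opposite sign, and with [i], [j] against [k], [l] both sides are 0. *)
Lemma sgk_block_sum Pi Phi Psi Theta N1 N2 A1 A2 S1 S2 h1 h2 :
  (block_sum (opair l1 l4) (opair r1 r4) N1 N2
   =1 sgk_rhs Pi Phi Psi Theta (block_sum l4 r4 A1 A2) (block_sum l2 r2 S1 S2)
        (block_sum l2 r2 h1 h2)) <->
  sgk_splitting Pi Phi Psi Theta N1 N2 A1 A2 S1 S2 h1 h2.
Proof.
split=> [H|[[H1 H1'] [[H2 H2'] [H3 H3']]]].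
  (* The four curvature conditions and the two mixed ones carry differently shaped multi-indices;
     both are named so that [H] at [(m, (i, j, k, l))] is the component to use. *)
  split; last split; split; first
    [ move=> [m [[[i j] k] l]] | move=> [[m [i l]] [j k]] ];
  rewrite /sgk_rhs /form_part /extend0 /opair4 /opair2 /opair /=;
  case: (split_ordP m) => ? mE; case: (split_ordP i) => ? iE;
  case: (split_ordP j) => ? jE; case: (split_ordP k) => ? kE;
  case: (split_ordP l) => ? lE; rewrite mE iE jE kE lE !idxE /= ?zeroE //;
  have := H (m, (i, j, k, l));
  rewrite /sgk_rhs /block_sum /opair4 /opair2 /opair /=;
  rewrite mE iE jE kE lE !idxE /= ?zeroE; lra.
move=> [m [[[i j] k] l]].
rewrite /sgk_rhs /block_sum /opair4 /opair2 /opair /=.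
case: (split_ordP m) => ? mE; case: (split_ordP i) => ? iE;
case: (split_ordP j) => ? jE; case: (split_ordP k) => ? kE;
case: (split_ordP l) => ? lE; rewrite mE iE jE kE lE !idxE /= ?zeroE //.
all: have := H1 (m, (i, j, k, l)); have := H1' (m, (i, j, k, l)).
all: have := H2 (m, (i, j, k, l)); have := H2' (m, (i, j, k, l)).
(* The mixed conditions require the first pair to lie in the same factor as [m], so both pairings
   are supplied in both orders. *)
all: have := H3 (m, (i, l), (j, k)); have := H3' (m, (i, l), (j, k)).
all: have := H3 (m, (j, k), (i, l)); have := H3' (m, (j, k), (i, l)).
all: have := H3 (m, (i, k), (j, l)); have := H3' (m, (i, k), (j, l)).
all: have := H3 (m, (j, l), (i, k)); have := H3' (m, (j, l), (i, k)).
all: rewrite /sgk_rhs /form_part /extend0 /opair4 /opair2 /opair /=.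
all: rewrite mE iE jE kE lE !idxE /= ?zeroE; lra.
Qed.

End SuperGeneralizedRecurrence.

(** At a fixed point of a product chart all tensors involved are block sums, the covariant
    derivative having been split beforehand; what remains is the algebraic equivalence. *)
Lemma sgk_pointwise (R : realType) (p q : nat) (M1 : manifold R p)
    (M2 : manifold R q) (g1 : metric M1) (g2 : metric M2)
    (Pi Phi Psi Theta : one_form (prod_manifold M1 M2))
    (c : chart (prod_manifold M1 M2)) y : cimg c y ->
  let g := prod_metric g1 g2 in
  let w (a : one_form (prod_manifold M1 M2)) := form_tensor a c y in
  let A1 := riemann g1 c.1 (lsubmx y) in let A2 := riemann g2 c.2 (rsubmx y) in
  let S1 := ricci g1 c.1 (lsubmx y) in let S2 := ricci g2 c.2 (rsubmx y) in
  let h1 := metric_tensor g1 c.1 (lsubmx y) in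
  let h2 := metric_tensor g2 c.2 (rsubmx y) in
  nabla_riemann g c y =1
    (form_tensor Pi \ox riemann g
     + form_tensor Phi \ox (ricci g \kn ricci g)
     + form_tensor Psi \ox (metric_tensor g \kn ricci g)
     + form_tensor Theta \ox (metric_tensor g \kn metric_tensor g)) c y <->
  sgk_splitting (w Pi) (w Phi) (w Psi) (w Theta)
    (nabla_riemann g1 c.1 (lsubmx y)) (nabla_riemann g2 c.2 (rsubmx y))
    A1 A2 S1 S2 h1 h2.
Proof.
move=> cy g w A1 A2 S1 S2 h1 h2; rewrite -sgk_block_sum.
rewrite nabla_riemann_prod // /A1 /A2 -riemann_prod // /S1 /S2 -ricci_prod //.
rewrite /h1 /h2 -metric_tensor_prod; split=> H mi; rewrite H;
(* The Kulkarni-Nomizu products reduce on explicit tuples, after which both forms of the right-hand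
   side are convertible. *)
by case: mi => m [[[i j] k] l].
Qed.

Theorem corollary4p2 (R : realType) (p q : nat)
    (M1 : manifold R p) (M2 : manifold R q) (g1 : metric M1) (g2 : metric M2)
    (p_gt0 : (0 < p)%N) (q_gt0 : (0 < q)%N) (dim_ge3 : (3 <= p + q)%N)
    (nonflat : ~ flat (prod_metric g1 g2))
    (Pi Phi Psi Theta : one_form (prod_manifold M1 M2)) :
  SGK (prod_metric g1 g2) Pi Phi Psi Theta <->
  forall x : prod_manifold M1 M2, nonrecurrent_set (prod_metric g1 g2) x ->
    (* 1 *)
    (teq_at x (base_nabla_riemann M2 g1)
       (base_part Pi \ox base_riemann M2 g1
        + base_part Phi \ox (base_ricci M2 g1 \kn base_ricci M2 g1)
        + base_part Psi \ox (base_metric M2 g1 \kn base_ricci M2 g1)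
        + base_part Theta \ox (base_metric M2 g1 \kn base_metric M2 g1)) /\
     teq_at x (- fibre_part Pi \ox base_riemann M2 g1)
       (fibre_part Phi \ox (base_ricci M2 g1 \kn base_ricci M2 g1)
        + fibre_part Psi \ox (base_metric M2 g1 \kn base_ricci M2 g1)
        + fibre_part Theta \ox (base_metric M2 g1 \kn base_metric M2 g1))) /\
    (* 2 *)
    (teq_at x (fibre_nabla_riemann M1 g2)
       (fibre_part Pi \ox fibre_riemann M1 g2
        + fibre_part Phi \ox (fibre_ricci M1 g2 \kn fibre_ricci M1 g2)
        + fibre_part Psi \ox (fibre_metric M1 g2 \kn fibre_ricci M1 g2)
        + fibre_part Theta \ox (fibre_metric M1 g2 \kn fibre_metric M1 g2)) /\
     teq_at x (- base_part Pi \ox fibre_riemann M1 g2)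
       (base_part Phi \ox (fibre_ricci M1 g2 \kn fibre_ricci M1 g2)
        + base_part Psi \ox (fibre_metric M1 g2 \kn fibre_ricci M1 g2)
        + base_part Theta \ox (fibre_metric M1 g2 \kn fibre_metric M1 g2))) /\
    (* 3 *)
    (teq_at x
       (((base_part Phi \ox base_ricci M2 g1) *+ 2
         + base_part Psi \ox base_metric M2 g1) \ox fibre_ricci M1 g2)
       (- (base_part Psi \ox base_ricci M2 g1
           + (base_part Theta \ox base_metric M2 g1) *+ 2)
        \ox fibre_metric M1 g2) /\
     teq_at x
       (((fibre_part Phi \ox fibre_ricci M1 g2) *+ 2
         + fibre_part Psi \ox fibre_metric M1 g2) \ox base_ricci M2 g1)
       (- (fibre_part Psi \ox fibre_ricci M1 g2
           + (fibre_part Theta \ox fibre_metric M1 g2) *+ 2)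
        \ox base_metric M2 g1)).
Proof.
(* Both sides range over the same points of U, so one point and one chart are treated at a time. *)
split=> H x Ux; last first.
  have [[H1 H1'] [[H2 H2'] [H3 H3']]] := H x Ux.
  move=> c cx; have cy : cimg c (cmap c x) by exists x.
  apply/(sgk_pointwise _ _ _ _ _ _ cy); split; last split; split.
  (* In a fixed chart the pullbacks unfold to [extend0] and the parts of the forms to [form_part],
     so each condition matches by conversion. *)
  - exact: H1.
  - exact: H1'.
  - exact: H2.
  - exact: H2'.
  - exact: H3.
  - exact: H3'.
have {}H c (cx : cdom c x) := (sgk_pointwise g1 g2 Pi Phi Psi Theta
  (ex_intro2 _ _ x cx erefl)).1 (H x Ux c cx).
split; last split; split=> c cx.
- exact: (H c cx).1.1.
- exact: (H c cx).1.2.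
- exact: (H c cx).2.1.1.
- exact: (H c cx).2.1.2.
- exact: (H c cx).2.2.1.
- exact: (H c cx).2.2.2.
Qed.
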